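(* Assume that $\lambda_{m-1}<\lambda_m$ if $m>1$, and $\lambda_M<\lambda_{M+1}$. Assume also that there is a real number $\underline\lambda_{M+1}$ and, with $\overline\lambda_{m-1}:=\lambda_{(m-1)h}$ if $m>1$, $$\lambda_{m-1}\le\overline\lambda_{m-1}<\lambda_{mh}\ \text{ when } m>1,\qquad\lambda_{Mh}<\underline\lambda_{M+1}\le\lambda_{M+1}.$$ Set $$c_h:=\max\left[\Big(\tfrac{\lambda_{mh}}{\overline\lambda_{m-1}}-1\Big)^{-1},\Big(1-\tfrac{\lambda_{Mh}}{\underline\lambda_{M+1}}\Big)^{-1}\right],$$ $$\tilde c_h:=\max\left[(\overline\lambda_{m-1})^{-1/2}\Big(\tfrac{\lambda_{mh}}{\overline\lambda_{m-1}}-1\Big)^{-1},(\underline\lambda_{M+1})^{-1/2}\Big(1-\tfrac{\lambda_{Mh}}{\underline\lambda_{M+1}}\Big)^{-1}\right],$$ the first term in each $\max$ being discarded for $m=1$. Then $$\|\gamma^0-\gamma_h\|_{\mathfrak S_2(\mathcal H)}\le\sqrt2\,c_h\,\|A^{-1/2}\mathrm{Res}(\gamma_h)\|_{\mathfrak S_2(\mathcal H)}$$ and $$\|\gamma^0-\gamma_h\|_{\mathfrak S_2(\mathcal H)}\le\sqrt2\,\tilde c_h\,\|\mathrm{Res}(\gamma_h)\|_{\mathfrak S_2(\mathcal H)}.$$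
   Context: $\mathcal H$ is a real separable Hilbert space with inner product $(\cdot,\cdot)$ and norm $\|\cdot\|$; $\|B\|_{\mathfrak S_2(\mathcal H)}$ is the Hilbert–Schmidt norm. $A$ is a self-adjoint, positive definite operator on $\mathcal H$ with domain $D(A)$ and compact resolvent; $(\lambda_k)_{k\ge1}$ is the nondecreasing sequence of its (positive) eigenvalues counted with multiplicity, $\lambda_k\to+\infty$, and $(\varphi_k^0)_{k\ge1}$ is an orthonormal basis of $\mathcal H$ with $A\varphi_k^0=\lambda_k\varphi_k^0$. For $s\in\mathbb{R}$, $D(A^s):=\{v\in\mathcal H:\sum_k\lambda_k^{2s}|(v,\varphi_k^0)|^2<\infty\}$ and $A^sv:=\sum_k\lambda_k^s(v,\varphi_k^0)\varphi_k^0$ (by convention $D(A^s)=\mathcal H$ for $s\le0$). Let $1\le m\le M$ be integers. $V_h\subset D(A^{1/2})$ is a finite-dimensional subspace with $\dim V_h\ge M$. The approximate eigenpairs $(\varphi_{kh},\lambda_{kh})\in V_h\times\mathbb{R}_+$, $1\le k\le\dim V_h$, satisfy $(\varphi_{kh},\varphi_{jh})=\delta_{kj}$, $(A^{1/2}\varphi_{kh},A^{1/2}v_h)=\lambda_{kh}(\varphi_{kh},v_h)$ for all $v_h\in V_h$, and $0<\lambda_{1h}\le\lambda_{2h}\le\cdots$ (counting multiplicities). The density matrices are $\gamma^0v:=\sum_{i=m}^M(v,\varphi_i^0)\varphi_i^0$ and $\gamma_hv:=\sum_{i=m}^M(v,\varphi_{ih})\varphi_{ih}$ for $v\in\mathcal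 H$. The cluster residual is the bounded operator $\mathrm{Res}(\gamma_h):=A^{1/2}\gamma_h-A^{-1/2}(A^{1/2}\gamma_h)^\dagger A^{1/2}\gamma_h$ on $\mathcal H$, where $B^\dagger$ denotes the adjoint of a bounded operator $B$. *)

(* Defs.v *)
From HB Require Import structures.
From mathcomp Require Import all_boot all_order all_algebra sesquilinear.
From mathcomp Require Import all_classical all_reals all_analysis.

Set Implicit Arguments.
Unset Strict Implicit.
Unset Printing Implicit Defensive.

Import Order.TTheory GRing.Theory Num.Theory.
Import numFieldNormedType.Exports.

Local Open Scope classical_set_scope.
Local Open Scope ring_scope.

(* A real Hilbert space is a complete normed module [H] over [R : realType]
   together with [dot : {dot H for idfun}] (a symmetric positive definite
   bilinear form) inducing its norm.

   All families [u : nat -> _] below are indexed from 1: their value at 0 is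
   never used. *)

Definition norm_induced_by (R : realType) (H : normedModType R)
    (dot : {dot H for idfun}) : Prop :=
  forall v : H, `|v| ^+ 2 = dot v v.

Definition separable (T : topologicalType) : Prop :=
  exists2 S : set T, countable S & dense S.

Section Operators.
Variables (R : realType) (H : normedModType R) (dot : {dot H for idfun}).

Definition linear_subspace (D : set H) : Prop :=
  D 0 /\ forall (a : R) (u v : H), D u -> D v -> D (a *: u + v).

(* Unbounded operators are pairs of a domain [D] and a function [A : H -> H]
   whose values outside [D] are irrelevant. *)

Definition linear_on (D : set H) (A : H -> H) : Prop :=
  linear_subspace D /\
  forall (a : R) (u v : H), D u -> D v -> A (a *: u + v) = a *: A u + A v.

(* The last clause says that the graph of [A] is the graph of its Hilbert
   space adjoint. *)
Definition self_adjoint (D : set H) (A : H -> H) : Prop :=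
  [/\ dense D, linear_on D A &
   forall w z : H,
     (D w /\ A w = z) <-> (forall v : H, D v -> dot (A v) w = dot v z)].

Definition positive_definite (D : set H) (A : H -> H) : Prop :=
  forall v : H, D v -> v != 0 -> 0 < dot (A v) v.

Definition compact_operator (T : H -> H) : Prop :=
  precompact (T @` ball (0 : H) 1).

Definition is_resolvent (D : set H) (A : H -> H) (mu : R) (T : H -> H) : Prop :=
  (forall f : H, D (T f) /\ A (T f) - mu *: T f = f) /\
  (forall v : H, D v -> T (A v - mu *: v) = v).

Definition compact_resolvent (D : set H) (A : H -> H) : Prop :=
  exists (mu : R) (T : H -> H), is_resolvent D A mu T /\ compact_operator T.

Definition orthonormal_basis (e : nat -> H) : Prop :=
  (forall j k : nat, (0 < j)%N -> (0 < k)%N -> dot (e j) (e k) = (j == k)%:R) /\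
  (forall v : H,
     (fun n => \sum_(1%N <= k < n) dot v (e k) *: e k) @ \oo --> v).

(* [lam] is the nondecreasing sequence of all eigenvalues of [A], counted with
   multiplicity, and [phi] an associated orthonormal basis of eigenvectors. *)
Definition spectral_basis (D : set H) (A : H -> H)
    (lam : nat -> R) (phi : nat -> H) : Prop :=
  [/\ orthonormal_basis phi,
      (forall k, (0 < k)%N -> D (phi k) /\ A (phi k) = lam k *: phi k),
      (forall k, (0 < k)%N -> 0 < lam k),
      (forall j k, (0 < j)%N -> (j <= k)%N -> lam j <= lam k) &
      lam @ \oo --> +oo].

(* Real powers of the operator with spectral basis [(lam, phi)].  The set
   [Apow_dom s] is all of [H] when [s <= 0], since then [lam k `^ (2 * s)] is
   bounded for [lam] as in [spectral_basis]. *)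
Definition Apow_dom (lam : nat -> R) (phi : nat -> H) (s : R) : set H :=
  [set v : H |
    (\sum_(1%N <= k <oo) (lam k `^ (2 * s) * `|dot v (phi k)| ^+ 2)%:E < +oo)%E].

Definition Apow (lam : nat -> R) (phi : nat -> H) (s : R) (v : H) : H :=
  lim ((fun n => \sum_(1%N <= k < n) (lam k `^ s * dot v (phi k)) *: phi k)
       @ \oo).

Definition subspace_of_dim (V : set H) (N : nat) : Prop :=
  exists b : 'I_N -> H,
    (forall c : 'I_N -> R, \sum_i c i *: b i = 0 -> forall i, c i = 0) /\
    V = [set v : H | exists c : 'I_N -> R, v = \sum_i c i *: b i].

Definition approx_eigenpairs (lam : nat -> R) (phi : nat -> H)
    (V : set H) (N : nat) (lamh : nat -> R) (phih : nat -> H) : Prop :=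
  [/\ (forall k, (1 <= k <= N)%N -> V (phih k)),
      (forall k j, (1 <= k <= N)%N -> (1 <= j <= N)%N ->
         dot (phih k) (phih j) = (k == j)%:R),
      (forall k, (1 <= k <= N)%N -> forall v, V v ->
         dot (Apow lam phi 2^-1 (phih k)) (Apow lam phi 2^-1 v)
         = lamh k * dot (phih k) v),
      (forall k, (1 <= k <= N)%N -> 0 < lamh k) &
      (forall j k, (1 <= j)%N -> (j <= k)%N -> (k <= N)%N ->
         lamh j <= lamh k)].

Definition density (phi : nat -> H) (m M : nat) (v : H) : H :=
  \sum_(m <= i < M.+1) dot v (phi i) *: phi i.

(* [adjoint B v] is the Riesz representer of [u |-> (B u, v)]; it exists (and
   is unique) for every bounded operator [B] on a Hilbert space. *)
Definition adjoint (B : H -> H) (v : H) : H :=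
  xget 0 [set w : H | forall u : H, dot (B u) v = dot u w].

Definition Res (lam : nat -> R) (phi : nat -> H) (G : H -> H) : H -> H :=
  let B := Apow lam phi 2^-1 \o G in
  B \- (Apow lam phi (- 2^-1) \o adjoint B \o B).

(* Hilbert-Schmidt norm, computed in an orthonormal basis [e]; the value, in
   [0, +oo], does not depend on that basis. *)
Definition hs_norm (e : nat -> H) (B : H -> H) : \bar R :=
  sqrte (\sum_(1%N <= k <oo) (`|B (e k)| ^+ 2)%:E)%E.

End Operators.

(* [max_discard m a b] is [max(a, b)] with [a] discarded when [m = 1]. *)
Definition max_discard (R : realType) (m : nat) (a b : R) : R :=
  if (1 < m)%N then Num.max a b else b.

(* [lb] stands for the upper bound of the [m-1]-st eigenvalue, [lm] and [lM] for
   the [m]-th and [M]-th approximate eigenvalues, and [lu] for the lower bound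
   of the [M+1]-st eigenvalue. *)
Definition c_h (R : realType) (m : nat) (lb lm lM lu : R) : R :=
  max_discard m (lm / lb - 1)^-1 (1 - lM / lu)^-1.

Definition ct_h (R : realType) (m : nat) (lb lm lM lu : R) : R :=
  max_discard m (lb `^ (- 2^-1) * (lm / lb - 1)^-1)
                (lu `^ (- 2^-1) * (1 - lM / lu)^-1).

(* Main.v *)
(* Write psi_i for the approximate eigenvectors of the cluster and
   r_i := A^(1/2) psi_i - lamh_i A^(-1/2) psi_i.  Since the A^(1/2) psi_i are
   orthogonal with squared norms lamh_i, Res(gamma_h) is the finite-rank
   operator v |-> \sum_i (v, psi_i) r_i, so its squared Hilbert-Schmidt norm is
   \sum_i |r_i|^2, whereas that of gamma^0 - gamma_h is
   2 \sum_i |psi_i - gamma^0 psi_i|^2.  In the basis phi, the coordinates of r_i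
   are lam_k^(1/2) (1 - lamh_i / lam_k) (psi_i, phi_k) and those of
   A^(-1/2) r_i are (1 - lamh_i / lam_k) (psi_i, phi_k).  Outside the cluster the
   gap conditions bound the factors in front of (psi_i, phi_k) from below, in
   absolute value, by the inverses of the two constants. *)
Require Import Defs.
From HB Require Import structures.
From mathcomp Require Import all_boot all_order all_algebra sesquilinear.
From mathcomp Require Import all_classical all_reals all_analysis.
From mathcomp Require Import ring.

Set Implicit Arguments.
Unset Strict Implicit.
Unset Printing Implicit Defensive.

Import Order.TTheory GRing.Theory Num.Theory.
Import numFieldNormedType.Exports.

Local Open Scope classical_set_scope.
Local Open Scope ring_scope.

(** * Inner product: Cauchy-Schwarz, continuity and Pythagoras *)

Section InnerProduct.
Variables (R : realType) (H : normedModType R) (dot : {dot H for idfun}).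

Lemma dotC (u v : H) : dot u v = dot v u.
Proof. by rewrite hermC expr0 mul1r. Qed.

Lemma dotZl (a : R) (u v : H) : dot (a *: u) v = a * dot u v.
Proof. exact: linearZl_LR. Qed.

Lemma dotZr (a : R) (u v : H) : dot u (a *: v) = a * dot u v.
Proof. by rewrite dotC dotZl dotC. Qed.

Lemma dotBl (u v w : H) : dot (u - v) w = dot u w - dot v w.
Proof. exact: linearBl. Qed.

Lemma dotBr (u v w : H) : dot w (u - v) = dot w u - dot w v.
Proof. exact: linearBr. Qed.

Lemma dot0r (u : H) : dot u 0 = 0.
Proof. exact: linear0r. Qed.

Lemma dot_suml (I : Type) (r : seq I) (P : pred I) (F : I -> H) (v : H) :
  dot (\sum_(i <- r | P i) F i) v = \sum_(i <- r | P i) dot (F i) v.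
Proof. exact: linear_sumlz. Qed.

Lemma dot_sumr (I : Type) (r : seq I) (P : pred I) (F : I -> H) (v : H) :
  dot v (\sum_(i <- r | P i) F i) = \sum_(i <- r | P i) dot v (F i).
Proof. exact: linear_sumr. Qed.

Lemma dot_inj (u v : H) : (forall w, dot w u = dot w v) -> u = v.
Proof.
move=> uv; apply/eqP; rewrite -subr_eq0; apply: contraT => uv0.
have : 0 < dot (u - v) (u - v) by exact: neq0_dnorm_gt0.
by rewrite dotBr uv subrr ltxx.
Qed.

Hypothesis hdot : norm_induced_by dot.

Lemma dot_le_norm (u v : H) : `|dot u v| <= `|u| * `|v|.
Proof.
have [->|v0] := eqVneq v 0; first by rewrite dot0r !normr0 mulr0.
have v2 : 0 < `|v| ^+ 2 by rewrite exprn_gt0 // normr_gt0.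
rewrite -(@ler_pXn2r _ 2) ?nnegrE ?mulr_ge0 // exprMn real_normK ?num_real //.
(* The component of [u] orthogonal to [v], scaled by |v|^2 to avoid division: |w|^2 = |v|^2 (|u|^2
   |v|^2 - (u, v)^2). *)
set w := dot v v *: u - dot u v *: v.
have : 0 <= dot w w by rewrite -hdot sqr_ge0.
rewrite /w dotBl !dotBr !dotZl !dotZr (dotC v u) -!hdot => h.
rewrite -subr_ge0 -(pmulr_rge0 _ v2); apply: le_trans h _.
by rewrite le_eqVlt; apply/orP; left; apply/eqP; ring.
Qed.

Lemma cvg_dot (f : nat -> H) (l w : H) :
  f @ \oo --> l -> (fun n => dot (f n) w) @ \oo --> dot l w.
Proof.
move=> /cvgrPdist_lt fl; apply/cvgrPdist_lt => eps eps0.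
(* Adding 1 keeps the denominator positive when [w] vanishes. *)
have w1 : 0 < `|w| + 1 by rewrite ltr_wpDl.
near=> n; rewrite -dotBl; apply: le_lt_trans (dot_le_norm _ _) _.
have : `|l - f n| < eps / (`|w| + 1).
  by near: n; apply: fl; rewrite divr_gt0.
rewrite ltr_pdivlMr //; apply: le_lt_trans.
by rewrite ler_wpM2l // lerDl.
Unshelve. all: by end_near. Qed.

Lemma norm_sum_orthogonal (e : nat -> H) (c : nat -> R) (n m : nat) :
  (forall j k, (0 < j)%N -> (0 < k)%N -> dot (e j) (e k) = (j == k)%:R) ->
  (0 < n)%N ->
  `|\sum_(n <= k < m) c k *: e k| ^+ 2 = \sum_(n <= k < m) c k ^+ 2.
Proof.
move=> oe n0; rewrite hdot dot_suml; apply: eq_big_nat => k /andP[nk km].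
rewrite dot_sumr (bigD1_seq k) ?iota_uniq ?mem_index_iota ?nk //=.
rewrite dotZl dotZr oe ?(leq_trans n0) // eqxx mulr1 -expr2.
rewrite big1_seq ?addr0 // => j; rewrite mem_index_iota => /and3P[jk nj _].
by rewrite dotZl dotZr oe ?(leq_trans n0) // eq_sym (negbTE jk) !mulr0.
Qed.

End InnerProduct.

(** * Parseval, Bessel, and Hilbert-Schmidt sums of finite-rank operators *)

Section OrthonormalBasis.
Variables (R : realType) (H : normedModType R) (dot : {dot H for idfun}).
Hypothesis hdot : norm_induced_by dot.
Variable e : nat -> H.
Hypothesis he : orthonormal_basis dot e.

Lemma parseval_dot (u v : H) :
  (fun n => \sum_(1%N <= k < n) dot u (e k) * dot v (e k)) @ \oo --> dot u v.
Proof.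
have := cvg_dot hdot (w := v) (he.2 u); apply: cvg_trans; apply: near_eq_cvg.
apply: nearW => n; rewrite dot_suml.
by apply: eq_bigr => k _; rewrite dotZl (dotC _ (e k)).
Qed.

Lemma parseval_norm (u : H) :
  (fun n => \sum_(1%N <= k < n) dot u (e k) ^+ 2) @ \oo --> `|u| ^+ 2.
Proof. by rewrite hdot; exact: parseval_dot. Qed.

(** Both vectors are the limit of the same expansion. The operator identities for the residual below
    are all checked this way, coordinate by coordinate in [phi]. *)
Lemma basis_ext (u v : H) :
  (forall k, (0 < k)%N -> dot u (e k) = dot v (e k)) -> u = v.
Proof.
move=> uv; apply: (cvg_unique (@norm_hausdorff _ _) (he.2 u)).
have := he.2 v; apply: cvg_trans; apply: near_eq_cvg; apply: nearW => n.
by apply: eq_big_nat => k /andP[k0 _]; rewrite uv.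
Qed.

Lemma coord_le_norm (c : R) (u v : H) : 0 <= c ->
  (forall k, (0 < k)%N -> `|dot u (e k)| <= c * `|dot v (e k)|) ->
  `|u| <= c * `|v|.
Proof.
move=> c0 uv; rewrite -(@ler_pXn2r _ 2) ?nnegrE ?mulr_ge0 // exprMn.
have cv : (fun n => c ^+ 2 * \sum_(1%N <= k < n) dot v (e k) ^+ 2) @ \oo -->
    c ^+ 2 * `|v| ^+ 2 by apply: cvgMr; exact: parseval_norm.
apply: (ler_cvg_to (@parseval_norm u) cv).
apply: nearW => n; rewrite mulr_sumr; apply: ler_sum_nat => k /andP[k0 _].
rewrite -(real_normK (num_real (dot u _))) -(real_normK (num_real (dot v _))).
by rewrite -exprMn ler_pXn2r ?nnegrE ?mulr_ge0 // uv.
Qed.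

Lemma bessel (u : H) (n : nat) :
  \sum_(1%N <= k < n) dot u (e k) ^+ 2 <= `|u| ^+ 2.
Proof.
have h := @parseval_norm u; rewrite -(cvg_lim (@Rhausdorff R) h).
apply: (nondecreasing_cvgn_le
  (u_ := fun n => \sum_(1%N <= k < n) dot u (e k) ^+ 2)).
  (* The sums start at 1, so they can be split at [i] only for [i >= 1]; at [i = 0] the smaller sum
     is empty. *)
  move=> i j ij; case: i ij => [|i] ij.
    by rewrite big_geq //; apply: sumr_ge0 => k _; exact: sqr_ge0.
  rewrite (big_cat_nat (ltn0Sn i) ij) //= lerDl.
  by apply: sumr_ge0 => k _; exact: sqr_ge0.
by apply/cvg_ex; exists (`|u| ^+ 2).
Qed.

(** The limit is the Hilbert-Schmidt inner product of two finite-rank operators. Bilinearity reduces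
    it to the sums over k of (p_i, e_k)(q_j, e_k), which Parseval evaluates; the result no longer
    involves [e]. *)
Lemma cvg_sum_hs (I J : Type) (r : seq I) (s : seq J)
    (p w : I -> H) (q z : J -> H) :
  (fun n => \sum_(1%N <= k < n)
      dot (\sum_(i <- r) dot (e k) (p i) *: w i)
          (\sum_(j <- s) dot (e k) (q j) *: z j)) @ \oo -->
  \sum_(i <- r) \sum_(j <- s) dot (p i) (q j) * dot (w i) (z j).
Proof.
have -> : (fun n => \sum_(1%N <= k < n)
      dot (\sum_(i <- r) dot (e k) (p i) *: w i)
          (\sum_(j <- s) dot (e k) (q j) *: z j)) =
   (fun n => \sum_(i <- r) \sum_(j <- s)
     (\sum_(1%N <= k < n) dot (p i) (e k) * dot (q j) (e k)) * dot (w i) (z j)).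
  apply/funext => n; under eq_bigr => k _ do rewrite dot_suml.
  rewrite exchange_big; apply: eq_bigr => i _.
  under eq_bigr => k _ do rewrite dot_sumr.
  rewrite exchange_big; apply: eq_bigr => j _.
  rewrite mulr_suml; apply: eq_bigr => k _.
  by rewrite dotZl dotZr !(dotC _ (e k)) mulrA.
apply: (cvg_big (op := +%R)); first exact: add_continuous.
move=> i _; apply: (cvg_big (op := +%R)); first exact: add_continuous.
by move=> j _; apply: cvgMl; exact: parseval_dot.
Qed.

(** Passes from limits of real partial sums to the extended-real series inside [hs_norm]. *)
Lemma hs_norm_cvg (B : H -> H) (x : R) :
  (fun n => \sum_(1%N <= k < n) `|B (e k)| ^+ 2) @ \oo --> x ->
  hs_norm e B = (Num.sqrt x)%:E.
Proof.
move=> Bx; rewrite /hs_norm.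
suff -> : (\sum_(1%N <= k <oo) (`|B (e k)| ^+ 2)%:E)%E = x%:E by [].
apply: cvg_lim => //.
under eq_fun => n do rewrite sumEFin.
exact: (cvg_comp _ _ Bx).
Qed.

End OrthonormalBasis.

(** * Riesz-Fischer: vectors with prescribed square-summable coordinates *)

Section RieszFischer.
Variables (R : realType) (H : completeNormedModType R).
Variable dot : {dot H for idfun}.
Hypothesis hdot : norm_induced_by dot.
Variable e : nat -> H.
Hypothesis he : orthonormal_basis dot e.

(** By Pythagoras the squared norm of a block of the vector series is the same block of the series
    of squares. The latter is monotone and bounded, hence Cauchy, and completeness concludes. *)
Lemma riesz_fischer_cvg (c : nat -> R) (C : R) :
  (forall n, \sum_(1%N <= k < n) c k ^+ 2 <= C) ->
  cvgn (fun n => \sum_(1%N <= k < n) c k *: e k).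
Proof.
move=> cC.
have : cvgn [sequence \sum_(1%N <= k < n) c k ^+ 2]_n.
  apply: nondecreasing_is_cvgn; last by exists C => _ [n _ <-]; exact: cC.
  move=> i j ij; case: i ij => [|i] ij.
    by rewrite /= big_geq //; apply: sumr_ge0 => k _; exact: sqr_ge0.
  rewrite /= (big_cat_nat (ltn0Sn i) ij) //= lerDl.
  by apply: sumr_ge0 => k _; exact: sqr_ge0.
rewrite is_cvg_series_restrict => /cauchy_cvgP/cauchy_seriesP cc.
rewrite (is_cvg_series_restrict 1 (fun k => c k *: e k)).
apply/cauchy_cvgP/cauchy_seriesP => eps eps0.
have : 0 < eps ^+ 2 by rewrite exprn_gt0.
move=> /cc [[A B] /= [[a _ aA] [b _ bB]]] AB.
(* Blocks must start at a positive index, since nothing is known about [e 0]. *)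
exists (A `&` [set n | (0 < n)%N], B) => /=.
  split; last by exists b.
  exists a.+1 => // n /= an; split; last exact: leq_ltn_trans an.
  by apply: aA; exact: ltnW.
case=> n m /= [[An n0] Bm].
have /= := AB (n, m) (conj An Bm).
rewrite -(norm_sum_orthogonal hdot _ _ he.1) // normrX normr_id.
by move: eps0 => /ltW eps0; rewrite ltr_pXn2r ?nnegrE.
Qed.

(** The [k]-th coordinate of the partial sums is constantly [c k] once [n > k], and [dot] is
    continuous. *)
Lemma riesz_fischer_coord (c : nat -> R) (C : R) (k : nat) :
  (forall n, \sum_(1%N <= k < n) c k ^+ 2 <= C) -> (0 < k)%N ->
  dot (lim ((fun n => \sum_(1%N <= k < n) c k *: e k) @ \oo)) (e k) = c k.
Proof.
move=> /riesz_fischer_cvg /(cvg_dot hdot (w := e k)) ck k0.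
apply: (cvg_unique (@Rhausdorff R) ck); apply: cvg_near_cst.
near=> n; have kn : (k < n)%N by near: n; exact: nbhs_infty_gt.
rewrite dot_suml (bigD1_seq k) ?iota_uniq ?mem_index_iota ?k0 //=.
rewrite dotZl he.1 // eqxx mulr1 big1_seq ?addr0 // => j.
rewrite mem_index_iota => /andP[jk /andP[j0 _]].
by rewrite dotZl he.1 // (negbTE jk) mulr0.
Unshelve. all: by end_near. Qed.

End RieszFischer.

(** * Hilbert-Schmidt distance between two density matrices *)

Section DensityMatrices.
Variables (R : realType) (H : normedModType R) (dot : {dot H for idfun}).
Hypothesis hdot : norm_induced_by dot.
Variables m M : nat.

(** Only cluster indices are constrained: the approximate eigenvectors are orthonormal only up to
    the dimension of [V]. *)
Definition orthonormal_family (p : nat -> H) : Prop :=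
  forall i j, (m <= i <= M)%N -> (m <= j <= M)%N ->
    dot (p i) (p j) = (i == j)%:R.

Lemma sum_orthonormal (p : nat -> H) (F : nat -> nat -> R) :
  orthonormal_family p ->
  \sum_(m <= i < M.+1) \sum_(m <= j < M.+1) dot (p i) (p j) * F i j =
  \sum_(m <= i < M.+1) F i i.
Proof.
move=> op; apply: eq_big_nat => i iI.
rewrite (bigD1_seq i) ?iota_uniq ?mem_index_iota //= op // eqxx mul1r.
rewrite big1_seq ?addr0 // => j; rewrite mem_index_iota => /andP[ji jI].
by rewrite op // eq_sym (negbTE ji) mul0r.
Qed.

Lemma norm_sub_density (p : nat -> H) (v : H) : orthonormal_family p ->
  `|v - density dot p m M v| ^+ 2 =
  `|v| ^+ 2 - \sum_(m <= i < M.+1) dot v (p i) ^+ 2.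
Proof.
move=> op; rewrite !hdot dotBl !dotBr.
have -> : dot (density dot p m M v) (density dot p m M v) =
    \sum_(m <= i < M.+1) dot v (p i) ^+ 2.
  rewrite dot_suml -(sum_orthonormal (fun i j => dot v (p i) * dot v (p j)) op).
  apply: eq_bigr => i _; rewrite dot_sumr; apply: eq_bigr => j _.
  by rewrite dotZl dotZr; ring.
have vE : dot v (density dot p m M v) = \sum_(m <= i < M.+1) dot v (p i) ^+ 2.
  by rewrite dot_sumr; apply: eq_bigr => i _; rewrite dotZr.
by rewrite (dotC _ (density dot p m M v)) vE; ring.
Qed.

Variable e : nat -> H.
Hypothesis he : orthonormal_basis dot e.

(** The squared norm is the double sum of (p_i, p_j)(w_i, w_j), of which orthonormality of [p] keeps
    the diagonal. *)
Lemma hs_norm_orthonormal_rank (p w : nat -> H) (B : H -> H) :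
  orthonormal_family p ->
  (forall v, B v = \sum_(m <= i < M.+1) dot v (p i) *: w i) ->
  hs_norm e B = (Num.sqrt (\sum_(m <= i < M.+1) `|w i| ^+ 2))%:E.
Proof.
move=> op BE; apply: hs_norm_cvg.
pose r := index_iota m M.+1.
have := @cvg_sum_hs _ _ _ hdot _ he _ _ r r p w p w.
rewrite (sum_orthonormal (fun i j => dot (w i) (w j)) op).
under [in X in _ -> X]eq_fun => n do under eq_bigr => k _ do rewrite hdot BE.
by under [in X in _ -> X]eq_bigr => i _ do rewrite hdot.
Qed.

(** Expanding the square gives two norms, each equal to the rank, minus twice the sum of the (p_i,
    q_j)^2. Since both ranks agree, this regroups as twice the sum over j of |q_j|^2 - \sum_i (q_j,
    p_i)^2, the squared distance from q_j to the span of [p]. *)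
Lemma hs_norm_density_sub (p q : nat -> H) :
  orthonormal_family p -> orthonormal_family q ->
  hs_norm e (density dot p m M \- density dot q m M)%R =
  (Num.sqrt
    (2 * \sum_(m <= j < M.+1) `|q j - density dot p m M (q j)| ^+ 2))%:E.
Proof.
move=> op oq; apply: hs_norm_cvg.
pose r := index_iota m M.+1.
have c1 := @cvg_sum_hs _ _ _ hdot _ he _ _ r r p p p p.
have c2 := @cvg_sum_hs _ _ _ hdot _ he _ _ r r q q q q.
have c3 := @cvg_sum_hs _ _ _ hdot _ he _ _ r r p p q q.
have -> : 2 * \sum_(m <= j < M.+1) `|q j - density dot p m M (q j)| ^+ 2 =
  \sum_(i <- r) \sum_(j <- r) dot (p i) (p j) * dot (p i) (p j) +
  \sum_(i <- r) \sum_(j <- r) dot (q i) (q j) * dot (q i) (q j) -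
  2 * \sum_(i <- r) \sum_(j <- r) dot (p i) (q j) * dot (p i) (q j).
  rewrite (sum_orthonormal (fun i j => dot (p i) (p j)) op).
  rewrite (sum_orthonormal (fun i j => dot (q i) (q j)) oq).
  under eq_bigr => j _ do rewrite norm_sub_density //.
  have oqE : forall f : nat -> H, orthonormal_family f ->
      \sum_(m <= i < M.+1) dot (f i) (f i) = \sum_(m <= i < M.+1) 1.
    by move=> f of_; apply: eq_big_nat => i iI; rewrite of_ // eqxx.
  (* Equality of ranks: the sum of the |p_i|^2 is traded for that of the |q_i|^2. *)
  rewrite (oqE p) // (oqE q) // -(oqE q) // sumrB.
  under eq_bigr => j _ do rewrite hdot.
  rewrite mulrBr; congr (_ - 2 * _); first by rewrite mulr_natl mulr2n.
  rewrite exchange_big; apply: eq_bigr => j _; apply: eq_bigr => i _.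
  by rewrite dotC expr2.
pose S (f g : nat -> H) n : R := \sum_(1 <= k < n)
  dot (density dot f m M (e k)) (density dot g m M (e k)).
have -> : (fun n => \sum_(1 <= k < n)
    `|(density dot p m M \- density dot q m M) (e k)| ^+ 2) =
    (fun n => S p p n + S q q n - 2 * S p q n).
  apply/funext => n.
  rewrite mulr_sumr -big_split -sumrB; apply: eq_bigr => k _.
  rewrite hdot /= dotBl !dotBr.
  by rewrite (dotC _ (density dot q m M _) (density dot p m M _)); ring.
apply: cvgB; first exact: cvgD.
by apply: cvgMr; exact: c3.
Qed.

End DensityMatrices.

(** * Spectral calculus: coordinates and domains of the powers of [A] *)

Section FractionalPowers.
Variables (R : realType) (H : completeNormedModType R).
Variable dot : {dot H for idfun}.
Hypothesis hdot : norm_induced_by dot.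
Variables (lam : nat -> R) (phi : nat -> H).
Hypothesis hphi : orthonormal_basis dot phi.
Hypothesis lam_gt0 : forall k, (0 < k)%N -> 0 < lam k.
Hypothesis lam_le : forall j k, (0 < j)%N -> (j <= k)%N -> lam j <= lam k.

(** Membership in the domain bounds the partial sums of the squared coefficients, so Riesz-Fischer
    applies to the limit defining [Apow]. *)
Lemma dot_Apow (s : R) (v : H) (k : nat) :
  Apow_dom dot lam phi s v -> (0 < k)%N ->
  dot (Apow dot lam phi s v) (phi k) = lam k `^ s * dot v (phi k).
Proof.
set S := (\sum_(1%N <= k <oo) (lam k `^ (2 * s) * `|dot v (phi k)| ^+ 2)%:E)%E.
move=> Sfin k0.
have t0 j : (0 <= (lam j `^ (2 * s) * `|dot v (phi j)| ^+ 2)%:E)%E.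
  by rewrite lee_fin mulr_ge0 ?powR_ge0 ?sqr_ge0.
apply: (@riesz_fischer_coord _ _ _ hdot _ hphi _ (fine S)) k0 => n.
rewrite -lee_fin fineK; last first.
  by rewrite ge0_fin_numE; [exact: Sfin|exact: nneseries_ge0].
have := @nneseries_lim_ge _ _ xpredT 1 n (fun j _ _ => t0 j).
apply: le_trans; rewrite sumEFin lee_fin; apply: ler_sum => j _.
rewrite exprMn real_normK ?num_real //.
by rewrite (mulrC 2) powRrM -[2]/(2%:R) powR_mulrn ?powR_ge0.
Qed.

(** For a nonpositive exponent the weights are at most that of [lam 1], so Bessel bounds the
    series. *)
Lemma Apow_dom_le0 (s : R) (v : H) : s <= 0 -> Apow_dom dot lam phi s v.
Proof.
move=> s0; apply: le_lt_trans (ltry (lam 1%N `^ (2 * s) * `|v| ^+ 2)).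
apply: lime_le.
  apply: is_cvg_nneseries => j _ _.
  by rewrite lee_fin mulr_ge0 ?powR_ge0 ?sqr_ge0.
apply: nearW => n; rewrite sumEFin lee_fin.
have := bessel hdot hphi v n.
move=> /(ler_wpM2l (powR_ge0 (lam 1%N) (2 * s))); apply: le_trans.
rewrite mulr_sumr; apply: ler_sum_nat => j /andP[j0 _].
rewrite real_normK ?num_real // ler_wpM2r ?sqr_ge0 //.
have s2 : 0 <= - (2 * s) by rewrite oppr_ge0 mulr_ge0_le0.
(* With t = -2s >= 0 the weights are inverses of t-th powers, and monotonicity for nonnegative
   exponents suffices. *)
rewrite -[2 * s]opprK; move: (- (2 * s)) s2 => t s2.
rewrite !powRN lef_pV2 ?posrE ?powR_gt0 ?lam_gt0 //.
by apply: (ge0_ler_powR s2); rewrite ?nnegrE ?lam_le ?ltW ?lam_gt0.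
Qed.

End FractionalPowers.

(** * Spectral gap bounds outside the cluster *)

Section SpectralGap.
Variable R : realType.

Lemma max_discard_ge_l (m : nat) (a b : R) :
  (1 < m)%N -> a <= max_discard m a b.
Proof. by move=> m1; rewrite /max_discard m1 le_max lexx. Qed.

Lemma max_discard_ge_r (m : nat) (a b : R) : b <= max_discard m a b.
Proof.
by rewrite /max_discard; case: ifP => // _; rewrite le_max lexx orbT.
Qed.

Variables (lam lamh : nat -> R) (m M : nat) (lu : R).
Hypothesis lam_gt0 : forall k, (0 < k)%N -> 0 < lam k.
Hypothesis lam_le : forall j k, (0 < j)%N -> (j <= k)%N -> lam j <= lam k.
Hypothesis lamh_gt0 : forall k, (1 <= k <= M)%N -> 0 < lamh k.
Hypothesis lamh_le : forall j k,
  (0 < j)%N -> (j <= k)%N -> (k <= M)%N -> lamh j <= lamh k.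
Hypothesis hm : (1 <= m)%N.
Hypothesis hmM : (m <= M)%N.
Hypothesis hlow : (1 < m)%N -> lam m.-1 <= lamh m.-1 /\ lamh m.-1 < lamh m.
Hypothesis hup : lamh M < lu /\ lu <= lam M.+1.

Let lu_gt0 : 0 < lu.
Proof. by apply: lt_trans hup.1; rewrite lamh_gt0 // (leq_trans hm) /=. Qed.

Let gap_up : 0 < 1 - lamh M / lu.
Proof. by rewrite subr_gt0 ltr_pdivrMr // mul1r hup.1. Qed.

Lemma c_h_ge0 : 0 <= c_h m (lamh m.-1) (lamh m) (lamh M) lu.
Proof.
apply: le_trans (max_discard_ge_r _ _ _).
by rewrite invr_ge0 ltW.
Qed.

Lemma ct_h_ge0 : 0 <= ct_h m (lamh m.-1) (lamh m) (lamh M) lu.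
Proof.
apply: le_trans (max_discard_ge_r _ _ _).
by rewrite mulr_ge0 ?powR_ge0 // invr_ge0 ltW.
Qed.

(** Below the cluster, lamh_i / lam_k - 1 is smallest with lamh_m over lamh_(m-1); above it, 1 -
    lamh_i / lam_k is smallest with lamh_M over [lu]. Each term of the maximum inverts one of these
    gaps. *)
Lemma c_h_gap (i k : nat) : (m <= i <= M)%N -> (0 < k)%N ->
  (k < m)%N || (M < k)%N ->
  1 <= c_h m (lamh m.-1) (lamh m) (lamh M) lu * `|1 - lamh i / lam k|.
Proof.
move=> /andP[mi iM] k0; have lk := lam_gt0 k0.
have step (a b x : R) : 0 < a -> a^-1 <= b -> a <= x -> 1 <= b * x.
  move=> a0 ab ax; apply: le_trans (_ : a^-1 * a <= _).
    by rewrite mulVf ?gt_eqF.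
  by apply: ler_pM => //; rewrite ?invr_ge0 ltW.
case/orP => [km|Mk].
  have m1 : (1 < m)%N by exact: leq_ltn_trans km.
  have [l1 l2] := hlow m1.
  have m10 : (0 < m.-1)%N by rewrite -ltnS prednK // ltnW.
  have lb0 : 0 < lamh m.-1 by apply: lt_le_trans l1; exact: lam_gt0.
  have lkb : lam k <= lamh m.-1.
    by apply: le_trans l1; apply: lam_le => //; rewrite -ltnS prednK // ltnW.
  apply: (@step (lamh m / lamh m.-1 - 1)).
  - by rewrite subr_gt0 ltr_pdivlMr // mul1r.
  - exact: max_discard_ge_l.
  (* Below the cluster 1 - lamh_i / lam_k is negative, hence the swap inside the absolute value. *)
  - rewrite distrC; apply: le_trans (ler_norm _); rewrite lerB //.
    apply: ler_pM; rewrite ?lamh_le ?invr_ge0 ?lef_pV2 ?posrE ?(ltW lb0) //.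
    by rewrite ltW // lamh_gt0 ?hm.
apply: step gap_up _ _; first exact: max_discard_ge_r.
apply: le_trans (ler_norm _); rewrite lerB //.
have luk : lu <= lam k by apply: le_trans hup.2 _; exact: lam_le.
have i0 : (0 < i)%N by exact: leq_trans mi.
apply: ler_pM; rewrite ?lamh_le ?invr_ge0 ?lef_pV2 ?posrE //; apply: ltW => //.
by rewrite lamh_gt0 ?i0.
Qed.

(** Same two cases with the extra weight sqrt(lam_k). Above the cluster both factors are bounded
    below separately; below it the weight goes the wrong way, and the product has to be treated as a
    whole. *)
Lemma ct_h_gap (i k : nat) : (m <= i <= M)%N -> (0 < k)%N ->
  (k < m)%N || (M < k)%N ->
  1 <= ct_h m (lamh m.-1) (lamh m) (lamh M) lu *
       `|Num.sqrt (lam k) * (1 - lamh i / lam k)|.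
Proof.
move=> /andP[mi iM] k0; have lk := lam_gt0 k0.
have i0 : (0 < i)%N by exact: leq_trans mi.
have li : 0 < lamh i by rewrite lamh_gt0 ?i0.
have step (a b x l : R) : 0 < a -> 0 < l -> l `^ (- 2^-1) * a^-1 <= b ->
    Num.sqrt l * a <= x -> 1 <= b * x.
  move=> a0 l0; rewrite powRN (powR12_sqrt (ltW l0)) => ab ax.
  have s0 : 0 < Num.sqrt l by rewrite sqrtr_gt0.
  have -> : 1 = ((Num.sqrt l)^-1 * a^-1) * (Num.sqrt l * a).
    by field; rewrite !gt_eqF.
  by apply: ler_pM => //; rewrite mulr_ge0 ?invr_ge0 // ltW.
case/orP => [km|Mk].
  have m1 : (1 < m)%N by exact: leq_ltn_trans km.
  have [l1 l2] := hlow m1.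
  have m10 : (0 < m.-1)%N by rewrite -ltnS prednK // ltnW.
  have lb0 : 0 < lamh m.-1 by apply: lt_le_trans l1; exact: lam_gt0.
  have lkb : lam k <= lamh m.-1.
    by apply: le_trans l1; apply: lam_le => //; rewrite -ltnS prednK // ltnW.
  apply: (@step (lamh m / lamh m.-1 - 1) _ _ (lamh m.-1)) => //.
  - by rewrite subr_gt0 ltr_pdivlMr // mul1r.
  - exact: max_discard_ge_l.
  - rewrite -normrN; apply: le_trans (ler_norm _).
    (* In the form x / sqrt(l) - sqrt(l) the product is visibly decreasing in [l], so lam_k may be
       replaced by the larger lamh_(m-1). *)
    have sE (x l : R) : 0 < l ->
        Num.sqrt l * (x / l - 1) = x / Num.sqrt l - Num.sqrt l.
      move=> l0; have s0 : 0 < Num.sqrt l by rewrite sqrtr_gt0.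
      by rewrite -{2}(sqr_sqrtr (ltW l0)); field; rewrite gt_eqF.
    rewrite -mulrN opprB !sE //; apply: lerB; last by rewrite ler_sqrt // ltW.
    apply: ler_pM; rewrite ?lamh_le ?invr_ge0 ?sqrtr_ge0 //.
      by rewrite ltW // lamh_gt0 ?hm.
    by rewrite lef_pV2 ?posrE ?sqrtr_gt0 // ler_sqrt // ltW.
have luk : lu <= lam k by apply: le_trans hup.2 _; exact: lam_le.
apply: step gap_up lu_gt0 _ _; first exact: max_discard_ge_r.
apply: le_trans (ler_norm _); apply: ler_pM.
- by rewrite sqrtr_ge0.
- exact: ltW gap_up.
- by rewrite ler_sqrt // ltW.
- rewrite lerB //; apply: ler_pM; rewrite ?lamh_le ?invr_ge0 ?lef_pV2 ?posrE //.
  all: exact: ltW.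
Qed.

End SpectralGap.

(** * Finite-rank form of the cluster residual *)

Section ClusterResidual.
Variables (R : realType) (H : completeNormedModType R).
Variable dot : {dot H for idfun}.
Hypothesis hdot : norm_induced_by dot.
Variables (lam : nat -> R) (phi : nat -> H).
Hypothesis hphi : orthonormal_basis dot phi.
Hypothesis lam_gt0 : forall k, (0 < k)%N -> 0 < lam k.
Hypothesis lam_le : forall j k, (0 < j)%N -> (j <= k)%N -> lam j <= lam k.

Let coord_half (v : H) (k : nat) : Apow_dom dot lam phi 2^-1 v -> (0 < k)%N ->
  dot (Apow dot lam phi 2^-1 v) (phi k) = Num.sqrt (lam k) * dot v (phi k).
Proof.
move=> vD k0; rewrite (dot_Apow hdot hphi vD k0).
by rewrite powR12_sqrt // ltW // lam_gt0.
Qed.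

Let coord_neghalf (v : H) (k : nat) : (0 < k)%N ->
  dot (Apow dot lam phi (- 2^-1) v) (phi k) =
  (Num.sqrt (lam k))^-1 * dot v (phi k).
Proof.
move=> k0; rewrite (dot_Apow hdot hphi) //.
  by rewrite powRN powR12_sqrt // ltW // lam_gt0.
by apply: (Apow_dom_le0 hdot hphi); rewrite // oppr_le0 invr_ge0.
Qed.

Variables (m M : nat) (psi : nat -> H) (lamh : nat -> R).
Hypothesis hm : (1 <= m)%N.
Hypothesis psi_dom : forall i, (m <= i <= M)%N ->
  Apow_dom dot lam phi 2^-1 (psi i).
Hypothesis density_dom : forall v,
  Apow_dom dot lam phi 2^-1 (density dot psi m M v).
Hypothesis energy_orthogonal : forall i j, (m <= i <= M)%N -> (m <= j <= M)%N ->
  dot (Apow dot lam phi 2^-1 (psi i)) (Apow dot lam phi 2^-1 (psi j)) =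
  lamh i * (i == j)%:R.

Definition residual (i : nat) : H :=
  Apow dot lam phi 2^-1 (psi i) - lamh i *: Apow dot lam phi (- 2^-1) (psi i).

Lemma residual_coord (i k : nat) : (m <= i <= M)%N -> (0 < k)%N ->
  dot (residual i) (phi k) =
  Num.sqrt (lam k) * (1 - lamh i / lam k) * dot (psi i) (phi k).
Proof.
move=> iI k0; have lk := lam_gt0 k0.
have s0 : 0 < Num.sqrt (lam k) by rewrite sqrtr_gt0.
rewrite dotBl dotZl coord_neghalf // (coord_half (psi_dom iI) k0).
(* The denominator [lam k] becomes a square, so that [field] sees the single atom
   [Num.sqrt (lam k)]. *)
rewrite -{4}(sqr_sqrtr (ltW lk)).
by field; rewrite gt_eqF.
Qed.

Lemma Apow_neghalf_residual_coord (i k : nat) : (m <= i <= M)%N -> (0 < k)%N ->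
  dot (Apow dot lam phi (- 2^-1) (residual i)) (phi k) =
  (1 - lamh i / lam k) * dot (psi i) (phi k).
Proof.
move=> iI k0; rewrite coord_neghalf // residual_coord // !mulrA mulVf ?mul1r //.
by rewrite gt_eqF // sqrtr_gt0 lam_gt0.
Qed.

(** Linearity is read off coordinates, which are known only on the domain of A^(1/2); hence the
    hypotheses [psi_dom] and [density_dom]. *)
Lemma Apow_half_density (v : H) :
  Apow dot lam phi 2^-1 (density dot psi m M v) =
  \sum_(m <= i < M.+1) dot v (psi i) *: Apow dot lam phi 2^-1 (psi i).
Proof.
apply: (basis_ext hphi) => k k0.
rewrite (coord_half (density_dom v) k0) !dot_suml mulr_sumr.
apply: eq_big_nat => i iI; rewrite !dotZl (coord_half (psi_dom iI) k0).
by rewrite mulrCA.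
Qed.

Lemma adjoint_Apow_half_density (v : H) :
  adjoint dot (Apow dot lam phi 2^-1 \o density dot psi m M) v =
  \sum_(m <= i < M.+1) dot (Apow dot lam phi 2^-1 (psi i)) v *: psi i.
Proof.
have adjE u : dot ((Apow dot lam phi 2^-1 \o density dot psi m M) u) v =
    dot u (\sum_(m <= i < M.+1) dot (Apow dot lam phi 2^-1 (psi i)) v *: psi i).
  rewrite /= Apow_half_density dot_suml dot_sumr; apply: eq_bigr => i _.
  by rewrite dotZl dotZr mulrC.
(* The explicit sum is a representer, so the default value of [xget] is excluded; any chosen
   representer equals it by uniqueness. *)
rewrite /adjoint; case: xgetP => [w _ /= wE|/(_ _ adjE)//].
by apply: (@dot_inj _ _ dot) => u; rewrite -wE adjE.
Qed.

(** With B = A^(1/2) gamma_h, orthogonality of the A^(1/2) psi_i turns the adjoint of B applied to B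
    v into \sum_i lamh_i (v, psi_i) psi_i. *)
Lemma Res_density (v : H) :
  Res dot lam phi (density dot psi m M) v =
  \sum_(m <= i < M.+1) dot v (psi i) *: residual i.
Proof.
rewrite /Res /= adjoint_Apow_half_density Apow_half_density.
apply: (basis_ext hphi) => k k0.
rewrite dotBl coord_neghalf // !dot_suml mulr_sumr -sumrB.
apply: eq_big_nat => i iI.
have aE : dot (Apow dot lam phi 2^-1 (psi i))
    (\sum_(m <= j < M.+1) dot v (psi j) *: Apow dot lam phi 2^-1 (psi j)) =
    lamh i * dot v (psi i).
  rewrite dot_sumr (bigD1_seq i) ?iota_uniq ?mem_index_iota //=.
  rewrite big1_seq ?addr0 => [|j].
    by rewrite dotZr energy_orthogonal // eqxx mulr1 mulrC.
  rewrite mem_index_iota => /andP[ji jI].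
  by rewrite dotZr energy_orthogonal // eq_sym (negbTE ji) !mulr0.
rewrite aE !dotZl residual_coord // (coord_half (psi_dom iI) k0).
have lk := lam_gt0 k0.
have s0 : 0 < Num.sqrt (lam k) by rewrite sqrtr_gt0.
by rewrite -{4}(sqr_sqrtr (ltW lk)); field; rewrite gt_eqF.
Qed.

Lemma Apow_neghalf_Res_density (v : H) :
  Apow dot lam phi (- 2^-1) (Res dot lam phi (density dot psi m M) v) =
  \sum_(m <= i < M.+1) dot v (psi i) *: Apow dot lam phi (- 2^-1) (residual i).
Proof.
rewrite Res_density; apply: (basis_ext hphi) => k k0.
rewrite coord_neghalf // !dot_suml mulr_sumr; apply: eq_big_nat => i iI.
by rewrite !dotZl coord_neghalf // mulrCA.
Qed.

Hypothesis psi_orthonormal : orthonormal_family dot m M psi.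
Variable e : nat -> H.
Hypothesis he : orthonormal_basis dot e.

(* [psi i - density phi (psi i)] has the coordinates of [psi i] outside the
   cluster and vanishing ones inside, so it suffices to compare coordinates
   outside the cluster. *)
Lemma hs_norm_density_sub_le (c : R) (w : nat -> H) (B : H -> H) :
  0 <= c -> (forall v, B v = \sum_(m <= i < M.+1) dot v (psi i) *: w i) ->
  (forall i k, (m <= i <= M)%N -> (0 < k)%N -> (k < m)%N || (M < k)%N ->
     `|dot (psi i) (phi k)| <= c * `|dot (w i) (phi k)|) ->
  (hs_norm e (density dot phi m M \- density dot psi m M)%R <=
   (Num.sqrt 2 * c)%:E * hs_norm e B)%E.
Proof.
move=> c0 BE wc.
have phi_orthonormal : orthonormal_family dot m M phi.
  by move=> i j /andP[mi _] /andP[mj _]; apply: hphi.1; exact: leq_trans hm _.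
rewrite (hs_norm_density_sub hdot he phi_orthonormal psi_orthonormal).
rewrite (hs_norm_orthonormal_rank hdot he psi_orthonormal BE) -EFinM lee_fin.
(* Writing [c] as the root of its square makes both sides single roots with a common factor 2, to be
   compared term by term. *)
rewrite -[c in leRHS](ger0_norm c0) -(sqrtr_sqr c) -mulrA -!sqrtrM ?sqr_ge0 //.
apply: ler_wsqrtr; rewrite ler_wpM2l // mulr_sumr.
apply: ler_sum_nat => i iI; rewrite -exprMn.
rewrite ler_pXn2r ?nnegrE ?mulr_ge0 //.
apply: (coord_le_norm hdot hphi) => // k k0.
have phiE j : (m <= j)%N -> dot (phi j) (phi k) = (j == k)%:R.
  by move=> mj; exact: hphi.1 (leq_trans hm mj) k0.
have -> : dot (psi i - density dot phi m M (psi i)) (phi k) =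
    if (k < m)%N || (M < k)%N then dot (psi i) (phi k) else 0.
  rewrite dotBl dot_suml; case: ifPn => [kO|].
    rewrite big_nat big1 ?subr0 // => j /andP[mj jM].
    rewrite dotZl phiE //.
    case: eqP => [jk|]; last by rewrite mulr0.
    by move: kO; rewrite -jk ltnNge mj ltnNge -ltnS jM.
  rewrite negb_or -!leqNgt => kI.
  rewrite (bigD1_seq k) ?iota_uniq ?mem_index_iota ?ltnS //=.
  rewrite dotZl hphi.1 // eqxx mulr1 big1_seq ?addr0 ?subrr // => j.
  rewrite mem_index_iota => /and3P[jk mj _].
  by rewrite dotZl phiE // (negbTE jk) mulr0.
by case: ifP => kO; [exact: wc|rewrite normr0 mulr_ge0].
Qed.

End ClusterResidual.

(** * From the discrete space [V] to the two error estimates *)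

Lemma subspace_of_dim_lincomb (R : realType) (H : normedModType R) (V : set H)
    (N m n : nat) (c : nat -> R) (f : nat -> H) :
  subspace_of_dim V N -> (forall i, (m <= i < n)%N -> V (f i)) ->
  V (\sum_(m <= i < n) c i *: f i).
Proof.
move=> [b [_ ->]] Vf; rewrite big_nat.
elim/big_rec: _ => [|i v iI [d ->]].
  by exists (fun=> 0); rewrite big1 // => i _; rewrite scale0r.
have [d' ->] := Vf i iI; exists (fun j => c i * d' j + d j).
rewrite scaler_sumr -big_split; apply: eq_bigr => j _.
by rewrite scalerDl scalerA.
Qed.

Theorem lemma4p7
  (R : realType) (H : completeNormedModType R) (dot : {dot H for idfun})
  (hdot : norm_induced_by dot) (hsep : separable H)
  (D : set H) (A : H -> H)
  (hA : self_adjoint dot D A) (hpos : positive_definite dot D A)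
  (hcomp : compact_resolvent D A)
  (lam : nat -> R) (phi : nat -> H) (hspec : spectral_basis dot D A lam phi)
  (m M : nat) (hm : (1 <= m)%N) (hmM : (m <= M)%N)
  (V : set H) (N : nat) (hVdim : subspace_of_dim V N) (hMN : (M <= N)%N)
  (hVdom : V `<=` Apow_dom dot lam phi 2^-1)
  (lamh : nat -> R) (phih : nat -> H)
  (happrox : approx_eigenpairs dot lam phi V N lamh phih)
  (hgap1 : (1 < m)%N -> lam m.-1 < lam m) (hgap2 : lam M < lam M.+1)
  (lu : R)
  (hlow : (1 < m)%N -> lam m.-1 <= lamh m.-1 /\ lamh m.-1 < lamh m)
  (hup : lamh M < lu /\ lu <= lam M.+1)
  (e : nat -> H) (he : orthonormal_basis dot e) :
  let gamma0 := density dot phi m M in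
  let gammah := density dot phih m M in
  let lb := lamh m.-1 in
  let c := c_h m lb (lamh m) (lamh M) lu in
  let ct := ct_h m lb (lamh m) (lamh M) lu in
  (hs_norm e (gamma0 \- gammah)%R <=
     (Num.sqrt 2 * c)%:E *
     hs_norm e (Apow dot lam phi (- 2^-1) \o Res dot lam phi gammah))%E /\
  (hs_norm e (gamma0 \- gammah)%R <=
     (Num.sqrt 2 * ct)%:E * hs_norm e (Res dot lam phi gammah))%E.
Proof.
move=> /=.
have [hphi _ lam_gt0 lam_le _] := hspec.
have [phihV phih_on phih_eig lamh_gt0 lamh_le] := happrox.
have inN i : (m <= i <= M)%N -> (1 <= i <= N)%N.
  by move=> /andP[mi iM]; rewrite (leq_trans hm mi) (leq_trans iM hMN).
have lamh_gt0' k : (1 <= k <= M)%N -> 0 < lamh k.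
  by move=> /andP[k0 kM]; rewrite lamh_gt0 // k0 (leq_trans kM).
have lamh_le' j k : (0 < j)%N -> (j <= k)%N -> (k <= M)%N -> lamh j <= lamh k.
  by move=> j0 jk kM; apply: lamh_le => //; exact: leq_trans hMN.
have psi_on : orthonormal_family dot m M phih.
  by move=> i j /inN iN /inN jN; exact: phih_on.
have psi_dom i : (m <= i <= M)%N -> Apow_dom dot lam phi 2^-1 (phih i).
  by move=> /inN iN; apply: hVdom; exact: phihV.
(* The range of gamma_h lies in [V], hence in the domain of A^(1/2). *)
have dens_dom v : Apow_dom dot lam phi 2^-1 (density dot phih m M v).
  apply: hVdom; apply: (subspace_of_dim_lincomb _ hVdim).
  by move=> i /inN; exact: phihV.
(* The discrete eigenvalue equation tested with another approximate eigenvector. *)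
have en i j : (m <= i <= M)%N -> (m <= j <= M)%N ->
    dot (Apow dot lam phi 2^-1 (phih i)) (Apow dot lam phi 2^-1 (phih j)) =
    lamh i * (i == j)%:R.
  by move=> /inN iN /inN jN; rewrite phih_eig ?phih_on //; exact: phihV.
(* Here [g] is the factor between a coordinate of psi_i and that of the residual vector; the gap
   lemmas supply the premise. *)
have le_coord (c g x : R) : 1 <= c * `|g| -> `|x| <= c * `|g * x|.
  by move=> cg; rewrite normrM mulrA ler_peMl.
split.
- apply: (hs_norm_density_sub_le hdot hphi hm psi_on he
    (w := fun i => Apow dot lam phi (- 2^-1)
      (residual dot lam phi phih lamh i))).
  + exact: (c_h_ge0 lamh_gt0' hm hmM hup).
  + by move=> v; exact: (Apow_neghalf_Res_density hdot hphi
      lam_gt0 lam_le psi_dom dens_dom en).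
  + move=> i k iI k0 kO.
    rewrite (Apow_neghalf_residual_coord hdot hphi
      lam_gt0 lam_le lamh psi_dom iI k0).
    by apply: le_coord; exact: (c_h_gap lam_gt0 lam_le lamh_gt0'
      lamh_le' hm hmM hlow hup).
- apply: (hs_norm_density_sub_le hdot hphi hm psi_on he
    (w := residual dot lam phi phih lamh)).
  + exact: (ct_h_ge0 lamh_gt0' hm hmM hup).
  + by move=> v; exact: (Res_density hdot hphi
      lam_gt0 lam_le psi_dom dens_dom en).
  + move=> i k iI k0 kO.
    rewrite (residual_coord hdot hphi lam_gt0 lam_le lamh psi_dom iI k0).
    by apply: le_coord; exact: (ct_h_gap lam_gt0 lam_le lamh_gt0'
      lamh_le' hm hmM hlow hup).
Qed.
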